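(* Let $k$ be an algebraically closed field of characteristic exponent $p\ge 1$, let $V$ be a finite dimensional $k$-vector space with a nondegenerate quadratic form $Q:V\to k$ and associated symmetric bilinear form $(v,v')=Q(v+v')-Q(v)-Q(v')$, let $G=SO(V)$ be the identity component of $O(V)=\{T\in GL(V);Q(Tv)=Q(v)\ \forall v\in V\}$, and let $\mathfrak g=\mathfrak o(V)$ be its Lie algebra. Let $V=\bigoplus_{i\in\mathbf Z}V_i$ be an $o$-good grading of $V$ and let $\delta:k^*\to G$ be the corresponding cocharacter, $\delta(a)|_{V_r}=a^r$ for all $a\in k^*$, $r\in\mathbf Z$. Then $$\mathfrak g_2^{\delta!}=\mathfrak o(V)_2^0 ,$$ that is: for $A\in\mathfrak o(V)$ with $A(V_r)\subset V_{r+2}$ for all $r$, the centralizer of $A$ in $G$ is contained in $G^\delta_{\ge0}$ if and only if both of the following hold: (i) for any odd $n\ge1$, $A^n:V_{-n}\to V_n$ is an isomorphism; (ii) for any even $n\ge0$, $A^{n/2}:V_{-n}\to V_0$ is injective and the restriction of $Q$ to $A^{n/2}(V_{-n})$ is nondegenerate.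
   Context: Nondegeneracy: a quadratic form $Q$ on a finite dimensional space $W$, with associated bilinear form having radical $\mathcal R$, is nondegenerate if $\mathcal R=0$ when $p\ne2$, and if $Q:\mathcal R\to k$ is injective when $p=2$. With $\mathcal R$ the radical of $(\,,)$ on $V$, $\mathfrak o(V)=\{T\in\mathrm{End}(V);(Tv,v)=0\ \forall v\in V,\ T|_{\mathcal R}=0\}$. A $\mathbf Z$-grading $V=\bigoplus_{i\in\mathbf Z}V_i$ is $o$-good if $\dim V_i=\dim V_{-i}\ge\dim V_{-i-2}$ for all $i\ge0$, $\dim V_i$ is even for any odd $i$, $(V_i,V_j)=0$ whenever $i+j\ne0$, and $Q|_{V_i}=0$ whenever $i\ne0$. (The cocharacters $\delta$ obtained from $o$-good gradings form the set denoted $\mathfrak D_G$.) For $i\in\mathbf Z$, $\mathfrak g_i^\delta=\{x\in\mathfrak g;\mathrm{Ad}(\delta(a))x=a^ix\ \forall a\in k^*\}=\mathfrak o(V)_i=\{A\in\mathfrak o(V);A(V_r)\subset V_{r+i}\ \forall r\}$. $G^\delta_{\ge0}$ is the parabolic subgroup of $G$ with Lie algebra $\bigoplus_{j\ge0}\mathfrak g_j^\delta$, i.e. the stabilizer in $G$ of all subspaces $V_{\ge a}=\sum_{j\ge a}V_j$. For $x\in\mathfrak g$, $G_x=\{g\in G;\mathrm{Ad}(g)x=x\}$, and $\mathfrak g_2^{\delta!}=\{x\in\mathfrak g_2^\delta;G_x\subset G^\delta_{\ge0}\}$. $\mathfrak o(V)_2^0$ is the set of all $A\in\mathfrak o(V)_2$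 satisfying (i) and (ii) of the claim. *)

(* Defs.v *)
From HB Require Import structures.
From mathcomp Require Import all_boot all_order all_algebra.
From mathcomp Require Import boolp classical_sets functions topology.

Set Implicit Arguments.
Unset Strict Implicit.
Unset Printing Implicit Defensive.
Import Order.TTheory GRing.Theory Num.Theory.
Local Open Scope classical_set_scope.
Local Open Scope ring_scope.

(* The algebra of functions on W generated by the linear functionals, i.e. the
   polynomials in the coordinates of W with respect to any basis. *)
Inductive polyfun (k : fieldType) (W : vectType k) : (W -> k) -> Prop :=
| polyfun_const (c : k) : polyfun (fun=> c)
| polyfun_scalar (f : {scalar W}) : polyfun f
| polyfun_add (f g : W -> k) :
    polyfun f -> polyfun g -> polyfun (fun w => f w + g w)
| polyfun_mul (f g : W -> k) :
    polyfun f -> polyfun g -> polyfun (fun w => f w * g w).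

(* The affine space W with its Zariski topology; the alias keeps it apart from
   any other topology on W. *)
Definition zariski (k : fieldType) (W : vectType k) : Type := W.

HB.instance Definition _ (k : fieldType) (W : vectType k) :=
  Choice.on (zariski W).

Section ZariskiTopology.
Context (k : fieldType) (W : vectType k).

(* Complements of the zero loci of sets of polynomials. *)
Definition zariski_open : set_system (zariski W) :=
  [set U | exists2 S : set (W -> k), S `<=` @polyfun k W
         & U = [set w | exists2 f, S f & f w != 0]].

Let zariski_openT : zariski_open setT.
Proof.
exists [set fun=> 1] => [_ ->|]; first exact: polyfun_const.
by apply/seteqP; split=> // w _; exists (fun=> 1) => //; exact: oner_neq0.
Qed.

Let zariski_openI : setI_closed zariski_open.
Proof.
move=> _ _ [S Spoly ->] [T Tpoly ->].
exists [set fun w => p.1 w * p.2 w | p in [set p | S p.1 /\ T p.2]].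
  by move=> _ [[f g] /= [Sf Tg] <-]; apply: polyfun_mul; [exact: Spoly|exact: Tpoly].
apply/seteqP; split=> w /=.
  move=> [[f Sf fw] [g Tg gw]]; exists (fun w => f w * g w).
    by exists (f, g).
  by rewrite mulf_neq0.
move=> [_ [[f g] /= [Sf Tg] <-]]; rewrite mulf_eq0 negb_or => /andP[fw gw].
by split; [exists f|exists g].
Qed.

Let zariski_open_bigU (I : Type) (U : I -> set (zariski W)) :
  (forall i, zariski_open (U i)) -> zariski_open (\bigcup_i U i).
Proof.
move=> Uop.
exists [set f | @polyfun k W f /\ [set w | f w != 0] `<=` \bigcup_i U i].
  by move=> f [].
apply/seteqP; split=> w /=; last by move=> [f [_ fU] fw]; exact: fU.
move=> [i _ Uiw]; have [S Spoly UE] := Uop i.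
move: Uiw; rewrite UE => -[f Sf fw]; exists f => //; split; first exact: Spoly.
by move=> v /= fv; exists i => //; rewrite UE; exists f.
Qed.

HB.instance Definition _ := isOpenTopological.Build (zariski W)
  zariski_openT zariski_openI zariski_open_bigU.

End ZariskiTopology.

Section OrthogonalGroup.
Context (k : closedFieldType) (V : vectType k) (Q : V -> k).

Definition polar (v w : V) : k := Q (v + w) - Q v - Q w.

(* Linearity of polar in its first argument follows by symmetry. *)
Definition quadratic_form : Prop :=
  (forall (a : k) (v : V), Q (a *: v) = a ^+ 2 * Q v) /\
  (forall v : V, scalar (polar v)).

Definition radical (W : {vspace V}) : set V :=
  [set w | w \in W /\ forall w', w' \in W -> polar w w' = 0].

Definition nondegenerate_on (W : {vspace V}) : Prop :=
  if 2%N \in [pchar k] then set_inj (radical W) Q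
  else radical W = [set 0].

(* Elements of GL(V) are represented by the injective endomorphisms of V. *)
Definition orthogonal_group : set (zariski 'End(V)) :=
  [set T : 'End(V) | lker T = 0%VS /\ forall v, Q (T v) = Q v].

(* The topology that O(V) inherits from End(V) is its Zariski topology as a
   closed subvariety of GL(V), since a principal open subset such as GL(V)
   carries the induced topology. *)
Definition special_orthogonal_group : set 'End(V) :=
  connected_component orthogonal_group (\1%VF : 'End(V)).

Definition orthogonal_algebra : set 'End(V) :=
  [set T | (forall v, polar (T v) v = 0) /\
           (forall v, radical fullv v -> T v = 0)].

Definition Ad (g x : 'End(V)) : 'End(V) := (g \o x \o g^-1)%VF.

Definition centralizer (x : 'End(V)) : set 'End(V) :=
  [set g | special_orthogonal_group g /\ Ad g x = x].

Definition lfun_pow (A : 'End(V)) (n : nat) : 'End(V) :=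
  iter n (comp_lfun A) \1%VF.

Section Grading.
Variable (Vi : int -> {vspace V}).

Definition grading : Prop :=
  (forall s : seq int, uniq s -> directv (\sum_(i <- s) Vi i)%VS) /\
  (forall v : V, exists s : seq int, v \in (\sum_(i <- s) Vi i)%VS).

Definition o_good : Prop :=
  [/\ grading,
      forall i : int, 0 <= i ->
        \dim (Vi i) = \dim (Vi (- i)) /\
        (\dim (Vi (- i - 2)) <= \dim (Vi (- i)))%N,
      forall i : int, odd `|i|%N -> ~~ odd (\dim (Vi i)),
      forall (i j : int) (v w : V),
        i + j != 0 -> v \in Vi i -> w \in Vi j -> polar v w = 0
    & forall (i : int) (v : V), i != 0 -> v \in Vi i -> Q v = 0].

(* The value of delta at 0 is irrelevant: its domain stands for k^*. *)
Definition cocharacter_of (delta : k -> 'End(V)) : Prop :=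
  forall (a : k) (r : int) (v : V),
    a != 0 -> v \in Vi r -> delta a v = a ^ r *: v.

Definition filtration (a : int) : set V :=
  [set v | exists2 s : seq int, all (fun j => a <= j) s
         & v \in (\sum_(j <- s) Vi j)%VS].

Definition parabolic : set 'End(V) :=
  [set g | special_orthogonal_group g /\
           forall a : int, g @` filtration a = filtration a].

Definition weight_space (delta : k -> 'End(V)) (i : int) : set 'End(V) :=
  [set x | orthogonal_algebra x /\
           forall a : k, a != 0 -> Ad (delta a) x = a ^ i *: x].

Definition weight_space_bang (delta : k -> 'End(V)) : set 'End(V) :=
  [set x | weight_space delta 2 x /\ centralizer x `<=` parabolic].

Definition orthogonal_algebra_deg (i : int) : set 'End(V) :=
  [set A | orthogonal_algebra A /\
           forall r : int, (A @: Vi r <= Vi (r + i))%VS].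

Definition odd_condition (A : 'End(V)) : Prop :=
  forall n : nat, odd n ->
    set_bij [set` Vi (- n%:Z)] [set` Vi n%:Z] (lfun_pow A n).

Definition even_condition (A : 'End(V)) : Prop :=
  forall n : nat, ~~ odd n ->
    set_inj [set` Vi (- n%:Z)] (lfun_pow A n./2) /\
    nondegenerate_on (lfun_pow A n./2 @: Vi (- n%:Z))%VS.

Definition orthogonal_algebra_deg2_0 : set 'End(V) :=
  [set A | [/\ orthogonal_algebra_deg 2 A, odd_condition A
             & even_condition A]].

End Grading.

End OrthogonalGroup.

(* Main.v *)
From HB Require Import structures.
Require Import Defs.
From mathcomp Require Import all_boot all_order all_algebra.
From mathcomp Require Import boolp classical_sets functions topology.
From mathcomp Require Import zify ring.

(* Both conditions together say that for all n and x in V_(-n): if A^n x = 0 and,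
   for n even, Q(A^(n/2) x) = 0, then x = 0.

   If this holds, the filtration is determined by A and Q, and is therefore
   preserved by the centralizer of A in O(V): descending from large a >= 0,
   V_(>= a+1) consists of the v orthogonal to V_(>= -a) with Q(v) = 0, and
   V_(>= -a+1) of the v in V_(>= -a) with A^a v in V_(>= a+1) and, for a even,
   Q(A^(a/2) v) = 0.

   If it fails, take x <> 0 violating it with n minimal.  Explicit maps 1 + B + C
   that centralize A, lower the degree and lie on a polynomial curve through 1 in
   O(V) contradict the inclusion in the parabolic.  If A x = 0 and n >= 2, an Eichler
   transformation built from x and some y in V_(n-2) killed by A works.  Otherwise
   A^(n-1) x <> 0; for n even one takes C = 0 and
   B v = sum_(i < n) (-1)^i (v, A^i x) A^(n-1-i) x.  For n odd this B is not
   skew, but (v, A^n w) is an alternating form on the even dimensional V_(-n), so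
   its radical contains a second vector y, and one antisymmetrizes in x and y. *)

Set Implicit Arguments.
Unset Strict Implicit.
Unset Printing Implicit Defensive.
Import Order.TTheory GRing.Theory Num.Theory.
Local Open Scope classical_set_scope.
Local Open Scope ring_scope.

(** * Alternating forms on odd-dimensional spaces *)

Section VectorSpaces.
Context (k : fieldType) (V : vectType k).

Lemma lfun_of_linear (W : vectType k) (f : V -> W) :
  linear f -> exists F : 'Hom(V, W), F =1 f.
Proof.
move=> lf; pose fL := GRing.isLinear.Build _ _ _ _ f lf.
pose fl : {linear V -> W} := HB.pack f fL.
by exists (linfun fl) => v; rewrite lfunE.
Qed.

Lemma dim_cap_ker_scalar (f : 'Hom(V, k^o)) (W : {vspace V}) (w : V) :
  w \in W -> f w != 0 -> \dim W = (\dim (W :&: lker f)).+1.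
Proof.
move=> Ww fw; rewrite -(limg_ker_dim f W) -addn1.
congr (_ + _)%N; apply/eqP; rewrite eqn_leq; apply/andP; split.
  by rewrite (leq_trans (dimvS (subvf _))) // dimvf.
rewrite lt0n dimv_eq0; apply: contra_neq fw => im0.
by have := memv_img f Ww; rewrite im0 memv0 => /eqP.
Qed.

(** Induction on dimension: a pair with [om v w != 0] spans a hyperbolic plane, whose orthogonal
    [W2] in [W] has dimension two less, hence odd. A radical vector of [W2] is also orthogonal to
    the plane. *)
Lemma alternating_odd_degenerate (om : V -> V -> k)
    (oml : forall w, scalar (om^~ w)) (omr : forall v, scalar (om v))
    (om0 : forall v, om v v = 0) (W : {vspace V}) :
  odd (\dim W) -> exists2 x, x \in W /\ x != 0 & forall w, w \in W -> om x w = 0.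
Proof.
have /choice[omL omLE] v : exists F : 'Hom(V, k^o), F =1 om v.
  exact: (@lfun_of_linear k^o (om v) (omr v)).
have omD v a b : om v (a + b) = om v a + om v b by rewrite -!omLE linearD.
have omZ v c b : om v (c *: b) = c * om v b by rewrite -!omLE linearZ.
have omDl w a b : om (a + b) w = om a w + om b w.
  by have := oml w 1 a b; rewrite scale1r mul1r.
have omC v w : om v w = - om w v.
  have := om0 (v + w); rewrite omD !omDl !om0 add0r addr0 addrC => /eqP.
  by rewrite addr_eq0 => /eqP.
have [m] := ubnP (\dim W); elim: m => // m IHm in W *; rewrite ltnS => leWm Wodd.
have W0 : W != 0%VS by apply: contraTneq Wodd => ->; rewrite dimv0.
have [omW0|] := pselect (forall v w, v \in W -> w \in W -> om v w = 0).
  by exists (vpick W); [rewrite memv_pick vpick0 | move=> w; apply: omW0; exact: memv_pick].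
move=> /existsNP[v /existsNP[w /not_implyP[Wv /not_implyP[Ww /eqP vw]]]].
set W1 := (W :&: lker (omL v))%VS.
set W2 := (W1 :&: lker (omL w))%VS.
have dW : \dim W = (\dim W1).+1 by apply: dim_cap_ker_scalar Ww _; rewrite omLE.
have W1v : v \in W1 by rewrite memv_cap Wv memv_ker omLE om0 eqxx.
have dW1 : \dim W1 = (\dim W2).+1.
  by apply: dim_cap_ker_scalar W1v _; rewrite omLE omC oppr_eq0.
have inW2 u : u \in W2 = [&& u \in W, om v u == 0 & om w u == 0].
  by rewrite !memv_cap !memv_ker !omLE andbA.
have [||x [W2x x0] xW2] := IHm W2; first by rewrite -ltnS -dW1; apply: leq_trans leWm; rewrite dW.
  by move: Wodd; rewrite dW dW1 /= negbK.
move: W2x; rewrite inW2 => /and3P[Wx /eqP vx /eqP wx]; exists x => // u Wu.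
have wv : om w v != 0 by rewrite omC oppr_eq0.
(* The projection of [u] to [W2] along the plane spanned by [v] and [w]. *)
pose u' := u + (- (om v u / om v w)) *: w + (- (om w u / om w v)) *: v.
have: om x u' = 0.
  apply: xW2; rewrite inW2 !memvD ?memvZ // !omD !omZ !om0.
  by rewrite !mulr0 !addr0 !mulNr !divfK // subrr subrr eqxx.
by rewrite !omD !omZ (omC x w) (omC x v) wx vx oppr0 !mulr0 !addr0.
Qed.

End VectorSpaces.

(** * Connected curves in the Zariski topology *)

Section ZariskiConnected.
Context (k : closedFieldType) (W : vectType k).

Lemma polyfun_curve (x b c : W) (f : W -> k) :
  polyfun f -> exists p : {poly k}, forall t, f (x + t *: b + t ^+ 2 *: c) = p.[t].
Proof.
elim=> {f} [a|f|f g _ [p pE] _ [q qE]|f g _ [p pE] _ [q qE]].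
- by exists a%:P => t; rewrite hornerC.
- exists ((f x)%:P + (f b)%:P * 'X + (f c)%:P * 'X^2) => t.
  by rewrite !hornerE !linearD !scalarZ /=; ring.
- by exists (p + q) => t; rewrite hornerD pE qE.
- by exists (p * q) => t; rewrite hornerM pE qE.
Qed.

(* A nonzero polynomial in one variable has a non-root, so any two nonempty
   open subsets of the curve meet. *)
Lemma connected_quadratic_curve (x b c : W) :
  connected (range (fun t : k => x + t *: b + t ^+ 2 *: c) : set (zariski W)).
Proof.
set A := range _ => B [z Bz] [O [S Spoly OE] BO] [C Cclosed BC].
move: Bz; rewrite BO OE => -[[t _ <-] [f Sf ft]]; rewrite -OE -BO.
apply: contrapT => BA.
(* [B] is cut out of the curve both by the open [O] and by the closed [C]. If it misses a point of
   the curve, then [O] and the complement of [C] both meet the curve, hence meet each other on it,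
   at a non-root of [p * q]. *)
have oC : open (~` C) by rewrite openC.
have [T Tpoly TE] := oC.
have [y [Ay By]] : exists y, A y /\ ~ B y.
  apply: contrapT => nE; apply: BA; apply/seteqP; split=> y; first by rewrite BO => -[].
  by move=> Ay; apply: contrapT => By; apply: nE; exists y.
have Cy : (~` C) y by move=> Cy; apply: By; rewrite BC.
move: Cy Ay; rewrite TE => -[g Tg gy] -[s _ sE]; rewrite -sE in gy.
have [p pE] := polyfun_curve x b c (Spoly _ Sf).
have [q qE] := polyfun_curve x b c (Tpoly _ Tg).
have pq0 : p * q != 0.
  rewrite mulf_neq0 //; [apply: contra_neq ft | apply: contra_neq gy] => z0.
    by rewrite pE z0 horner0.
  by rewrite qE z0 horner0.
have /closed_nonrootP[r] := pq0.
rewrite rootE hornerM mulf_eq0 negb_or -pE -qE => /andP[fr gr].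
have Br : B (x + r *: b + r ^+ 2 *: c) by rewrite BO; split; [exists r | rewrite OE; exists f].
have : (~` C) (x + r *: b + r ^+ 2 *: c) by rewrite TE; exists g.
by apply; move: Br; rewrite BC => -[].
Qed.

End ZariskiConnected.

(** * Gradings *)

Section GradingProjections.
Context (k : closedFieldType) (V : vectType k) (Vi : int -> {vspace V}).
Context (gr : grading Vi).

Lemma grading_cap i s : uniq (i :: s) -> (Vi i :&: \sum_(j <- s) Vi j = 0)%VS.
Proof.
move=> us; have := gr.1 _ us; have /andP[_ us'] := us; have := gr.1 _ us'.
rewrite !directvE /= !big_cons => /eqP ds /eqP; rewrite -ds => dis.
apply/eqP; rewrite -dimv_eq0; have := dimv_sum_cap (Vi i) (\sum_(j <- s) Vi j).
by rewrite dis -[RHS]addn0 => /addnI ->.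
Qed.

(** Finitely many degrees suffice for a basis. Duplicates are removed because directness is only
    available for duplicate-free lists. *)
Lemma grading_support : exists2 s : seq int, uniq s & (\sum_(i <- s) Vi i)%VS = fullv.
Proof.
have undupE s : (\sum_(i <- undup s) Vi i <= \sum_(i <- s) Vi i)%VS /\
    (\sum_(i <- s) Vi i <= \sum_(i <- undup s) Vi i)%VS.
  elim: s => [|i s [IH1 IH2]] /=; first by rewrite !big_nil subvv.
  rewrite big_cons; case: ifP => [si|_]; last by rewrite big_cons !addvS ?subvv.
  split; first exact: subv_trans IH1 (addvSr _ _).
  by rewrite subv_add IH2 andbT (big_rem i) ?mem_undup //= addvSl.
have [s sE] : exists s : seq int, forall v, v \in (vbasis {:V} : seq V) -> v \in (\sum_(i <- s) Vi i)%VS.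
  elim: (vbasis {:V} : seq V) => [|v b [s sE]]; first by exists [::] => v; rewrite in_nil.
  have [s' s'E] := gr.2 v; exists (s' ++ s) => w; rewrite inE => /predU1P[->|/sE ws].
    by rewrite big_cat /= (subvP (addvSl _ _)).
  by rewrite big_cat /= (subvP (addvSr _ _)).
exists (undup s); first exact: undup_uniq.
apply/eqP; rewrite eqEsubv subvf /= -(span_basis (vbasisP {:V})).
by apply/span_subvP => v /sE vs; exact: (subvP (undupE s).2).
Qed.

Lemma grading_projections : exists pr : int -> 'End(V),
  [/\ forall i v, pr i v \in Vi i,
      forall i v, v \in Vi i -> pr i v = v,
      forall i j v, v \in Vi i -> j != i -> pr j v = 0
    & exists2 s : seq int, uniq s & forall v, v = \sum_(i <- s) pr i v].
Proof.
have [s us sf] := grading_support.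
pose S i := (\sum_(j <- [seq j <- s | j != i]) Vi j)%VS.
have dis i : (Vi i :&: S i = 0)%VS.
  by apply: grading_cap; rewrite /= filter_uniq // mem_filter /= eqxx.
have VS i j : j != i -> (Vi j <= S i)%VS.
  move=> ji; have [sj|sj] := boolP (j \in s).
    by rewrite /S (big_rem j) ?mem_filter /= ?ji ?addvSl.
  (* Directness for [j :: s] makes [Vi j] meet the whole space trivially, so degrees outside the
     support carry nothing. *)
  suff -> : Vi j = 0%VS by rewrite sub0v.
  by rewrite -(grading_cap (i := j) (s := s)) /= ?sj // sf capvf.
have SV i : (Vi i + S i)%VS = fullv.
  apply/eqP; rewrite eqEsubv subvf /= -sf.
  elim: s {us sf dis VS} @S => [|j s IH] S; first by rewrite big_nil sub0v.
  rewrite big_cons subv_add /S /=; case: eqVneq => [->|ji].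
    by rewrite addvSl; exact: IH.
  rewrite big_cons; apply/andP; split.
    by apply: subv_trans (addvSr _ _); rewrite addvSl.
  by apply: subv_trans IH _; rewrite addvS ?subvv ?addvSr.
pose pr i := daddv_pi (Vi i) (S i); exists pr.
have prV i v : pr i v \in Vi i by apply: memv_pi.
have prid i v : v \in Vi i -> pr i v = v by move=> vi; exact: daddv_pi_id.
have pr0 i j v : v \in Vi i -> j != i -> pr j v = 0.
  move=> vi ji; have vS : v \in S j by apply: (subvP (VS _ _ _)) vi; rewrite eq_sym.
  have := daddv_pi_add (dis j) (subvP (addvSr _ _) v vS).
  by rewrite (@daddv_pi_id _ _ (S j) (Vi j)) 1?capvC // => /(canRL (addrK _)); rewrite subrr.
split=> //; exists s => // v.
have [w wV wE] : exists2 w : int -> V, forall i, w i \in Vi i & \sum_(i <- s) w i = v.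
  exists (fun i => sumv_pi (\sum_(i <- s) Vi i)%VS i v) => [i|]; first exact: memv_sum_pi.
  by apply: sumv_pi_uniq_sum; rewrite ?filter_predT // sf memvf.
rewrite -{1}wE; apply: eq_big_seq => j sj; rewrite -wE linear_sum (bigD1_seq j) //=.
by rewrite prid // big1 ?addr0 // => i ij; apply: pr0 (wV i) _; rewrite eq_sym.
Qed.

End GradingProjections.

(** * Quadratic forms and the orthogonal group *)

Section QuadraticForm.
Context (k : closedFieldType) (V : vectType k) (Q : V -> k) (hQ : quadratic_form Q).
Local Notation polar := (polar Q).

Lemma polarC v w : polar v w = polar w v.
Proof. by rewrite /Defs.polar [v + w]addrC addrAC. Qed.

Lemma polarDr v a b : polar v (a + b) = polar v a + polar v b.
Proof. by have := hQ.2 v 1 a b; rewrite scale1r mul1r. Qed.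

Lemma polar0r v : polar v 0 = 0.
Proof. by apply: (addrI (polar v 0)); rewrite -polarDr !addr0. Qed.

Lemma polarZr v c a : polar v (c *: a) = c * polar v a.
Proof. by have := hQ.2 v c a 0; rewrite polar0r !addr0. Qed.

Lemma polarNr v a : polar v (- a) = - polar v a.
Proof. by rewrite -scaleN1r polarZr mulN1r. Qed.

Lemma polarBr v a b : polar v (a - b) = polar v a - polar v b.
Proof. by rewrite polarDr polarNr. Qed.

Lemma polar_sumr v I (r : seq I) (F : I -> V) :
  polar v (\sum_(i <- r) F i) = \sum_(i <- r) polar v (F i).
Proof. exact: (big_morph _ (polarDr v) (polar0r v)). Qed.

Lemma polarDl v a b : polar (a + b) v = polar a v + polar b v.
Proof. by rewrite !(polarC _ v) polarDr. Qed.

Lemma polar0l v : polar 0 v = 0.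
Proof. by rewrite polarC polar0r. Qed.

Lemma polarZl v c a : polar (c *: a) v = c * polar a v.
Proof. by rewrite !(polarC _ v) polarZr. Qed.

Lemma polarNl v a : polar (- a) v = - polar a v.
Proof. by rewrite !(polarC _ v) polarNr. Qed.

Lemma polarBl v a b : polar (a - b) v = polar a v - polar b v.
Proof. by rewrite polarDl polarNl. Qed.

Lemma polar_suml v I (r : seq I) (F : I -> V) :
  polar (\sum_(i <- r) F i) v = \sum_(i <- r) polar (F i) v.
Proof. by rewrite polarC polar_sumr; under eq_bigr do rewrite polarC. Qed.

Lemma quadD v w : Q (v + w) = Q v + Q w + polar v w.
Proof. by rewrite /Defs.polar; ring. Qed.

Lemma quadZ c v : Q (c *: v) = c ^+ 2 * Q v.
Proof. exact: hQ.1. Qed.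

Lemma quad0 : Q 0 = 0.
Proof. by rewrite -(scale0r 0) quadZ expr0n mul0r. Qed.

Lemma quadN v : Q (- v) = Q v.
Proof. by rewrite -scaleN1r quadZ sqrrN expr1n mul1r. Qed.

Lemma polarvv v : polar v v = Q v *+ 2.
Proof. by rewrite /Defs.polar -mulr2n -scaler_nat quadZ; ring. Qed.

Lemma quad_sum0 I (r : seq I) (F : I -> V) :
    (forall i, Q (F i) = 0) -> (forall i j, polar (F i) (F j) = 0) ->
  Q (\sum_(i <- r) F i) = 0.
Proof.
move=> QF pF; elim: r => [|i r IH]; first by rewrite big_nil quad0.
by rewrite big_cons quadD QF IH polar_sumr big1 ?addr0.
Qed.

(** A characteristic-free form of the definition. When 2 is invertible, [polar v v = 2 Q v] makes
    [Q] vanish on the radical; in characteristic 2, [Q] is additive on the radical, so injectivity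
    means trivial kernel. *)
Lemma nondegenerate_onP (W : {vspace V}) : nondegenerate_on Q W <->
  forall v, v \in W -> (forall w, w \in W -> polar v w = 0) -> Q v = 0 -> v = 0.
Proof.
have rad0 : radical Q W 0 by split=> [|w _]; rewrite ?mem0v ?polar0l.
rewrite /nondegenerate_on; case: ifPn => char2; split.
- move=> injQ v Wv Wv0 Qv; apply: injQ; rewrite ?quad0 //; apply/mem_set => //.
- move=> ndW v w /set_mem[Wv v0] /set_mem[Ww w0] Qvw.
  apply/eqP; rewrite -subr_eq0; apply/eqP/ndW; first by rewrite memvB.
    by move=> u Wu; rewrite polarBl v0 ?w0 ?subr0.
  rewrite quadD quadN polarNr v0 // oppr0 addr0 Qvw -mulr2n -mulr_natr.
  by move: char2; rewrite inE => /andP[_ /eqP ->]; rewrite mulr0.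
- by move=> radW v Wv Wv0 _; have : radical Q W v by []; rewrite radW.
- move=> ndW; apply/seteqP; split=> v /=; last by move=> ->.
  case=> Wv v0; apply: ndW => //; have /eqP := v0 v Wv; rewrite polarvv.
  by rewrite -mulr_natr mulf_eq0; case/orP => /eqP // z2; move: char2; rewrite inE /= z2 eqxx.
Qed.

Section Isometries.
Context (hnd : nondegenerate_on Q fullv).

Lemma nondegenerate_eq0 v : (forall w, polar v w = 0) -> Q v = 0 -> v = 0.
Proof. by move=> v0; apply: (nondegenerate_onP fullv).1 => //; rewrite memvf. Qed.

Lemma isometry_polar (g : 'End(V)) : (forall v, Q (g v) = Q v) ->
  forall v w, polar (g v) (g w) = polar v w.
Proof. by move=> gQ v w; rewrite /Defs.polar -linearD !gQ. Qed.

Lemma isometry_orthogonal_group (g : 'End(V)) :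
  (forall v, Q (g v) = Q v) -> orthogonal_group Q g.
Proof.
move=> gQ; split=> //; apply/eqP; rewrite -subv0; apply/subvP => v.
rewrite memv_ker memv0 => /eqP gv; apply/eqP/nondegenerate_eq0 => [w|].
  by rewrite -(isometry_polar gQ) gv polar0l.
by rewrite -gQ gv quad0.
Qed.

(** The curve is a connected set of isometries through the identity at [t = 0] and the given map at
    [t = 1]. *)
Lemma quadratic_curve_special_orthogonal (B C : 'End(V)) :
    (forall t v, Q (v + t *: B v + t ^+ 2 *: C v) = Q v) ->
  special_orthogonal_group Q (\1 + B + C)%VF.
Proof.
move=> curveQ.
exists (range (fun t : k => \1%VF + t *: B + t ^+ 2 *: C)); last first.
  by exists 1 => //; rewrite expr1n !scale1r.
split; last exact: connected_quadratic_curve.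
  by exists 0 => //; rewrite expr0n !scale0r !addr0.
move=> _ [t _ <-]; apply: isometry_orthogonal_group => v.
by rewrite !add_lfunE !scale_lfunE id_lfunE curveQ.
Qed.

Lemma special_orthogonal_isometry (g : 'End(V)) :
  special_orthogonal_group Q g -> orthogonal_group Q g.
Proof. by move/connected_component_sub. Qed.

End Isometries.

Section OrthogonalAlgebra.
Context (A : 'End(V)) (hA : orthogonal_algebra Q A).
Local Notation "A ^^ n" := (lfun_pow A n) (at level 29).

Lemma lfun_powS n v : (A ^^ n.+1) v = A ((A ^^ n) v).
Proof. by rewrite /lfun_pow iterS comp_lfunE. Qed.

Lemma lfun_pow0 v : (A ^^ 0) v = v.
Proof. by rewrite /lfun_pow /= id_lfunE. Qed.

Lemma lfun_powD m n v : (A ^^ (m + n)) v = (A ^^ m) ((A ^^ n) v).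
Proof. by elim: m => [|m IH]; rewrite ?lfun_pow0 // addSn !lfun_powS IH. Qed.

Lemma lfun_powSr n v : (A ^^ n.+1) v = (A ^^ n) (A v).
Proof. by rewrite -addn1 lfun_powD lfun_powS lfun_pow0. Qed.

Lemma orthogonal_algebra_skew v w : polar (A v) w = - polar v (A w).
Proof.
have := hA.1 (v + w); rewrite linearD polarDl !polarDr !hA.1 add0r addr0.
by move/eqP; rewrite addr_eq0 (polarC v) => /eqP.
Qed.

Lemma polar_lfun_pow n v w : polar ((A ^^ n) v) w = (-1) ^+ n * polar v ((A ^^ n) w).
Proof.
elim: n w => [|n IH] w; first by rewrite !lfun_pow0 expr0 mul1r.
by rewrite lfun_powS orthogonal_algebra_skew IH -lfun_powSr exprS mulN1r mulNr.
Qed.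

End OrthogonalAlgebra.

End QuadraticForm.

(** * The filtration of a grading *)

Section Graded.
Context (k : closedFieldType) (V : vectType k) (Vi : int -> {vspace V}).
Context (pr : int -> 'End(V)).
Context (prV : forall i v, pr i v \in Vi i).
Context (pr_id : forall i v, v \in Vi i -> pr i v = v).
Context (pr_out : forall i j v, v \in Vi i -> j != i -> pr j v = 0).
Context (s0 : seq int) (pr_sum : forall v, v = \sum_(i <- s0) pr i v).

Lemma homogeneous_ext (W : vectType k) (f g : 'Hom(V, W)) :
  (forall i v, v \in Vi i -> f v = g v) -> f =1 g.
Proof.
move=> fg v; rewrite [v]pr_sum !linear_sum; apply: eq_bigr => i _.
by apply: fg (prV i v).
Qed.

Lemma pr_homogeneous (f : 'End(V)) (d : int) :
    (forall i v, v \in Vi i -> f v \in Vi (i + d)) ->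
  forall j v, pr j (f v) = f (pr (j - d) v).
Proof.
move=> fd j v; rewrite -!comp_lfunE; apply: homogeneous_ext => i w wi.
rewrite !comp_lfunE; case: (eqVneq j (i + d)) => [->|ji].
  by rewrite addrK !pr_id ?fd.
rewrite (pr_out (fd _ _ wi)) // (pr_out wi) ?linear0 //.
by apply: contraNneq ji => <-; rewrite subrK.
Qed.

(** [filtration] read through the projections, with no list of degrees to choose. *)
Definition filtered (a : int) (v : V) : Prop := forall j, j < a -> pr j v = 0.

Lemma filtrationP a v : filtration Vi a v <-> filtered a v.
Proof.
split=> [[s sa vs] j ja|va].
  apply/eqP; rewrite -memv_ker; apply: (subvP _ v vs).
  elim: s sa {vs} => [|i s IH] /=; first by rewrite big_nil sub0v.
  case/andP=> ai sa; rewrite big_cons subv_add IH // andbT.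
  apply/subvP => w wi; rewrite memv_ker (pr_out wi) //.
  by rewrite lt_eqF // (lt_le_trans ja).
exists [seq i <- s0 | a <= i]; first exact: filter_all.
rewrite {1}[v]pr_sum; elim: (s0) => [|i s IH]; first by rewrite !big_nil mem0v.
rewrite big_cons /=; case: leP => ai; last by rewrite va // add0r.
by rewrite big_cons memv_add.
Qed.

Lemma filtered_homogeneous i a v : v \in Vi i -> a <= i -> filtered a v.
Proof. by move=> vi ai j ja; rewrite (pr_out vi) // lt_eqF // (lt_le_trans ja). Qed.

Lemma filtered_le a b v : a <= b -> filtered b v -> filtered a v.
Proof. by move=> ab vb j ja; apply: vb; apply: lt_le_trans ab. Qed.

Lemma filtered_split a v : filtered a v -> filtered (a + 1) (v - pr a v).
Proof.
move=> va j; rewrite ltzD1 le_eqVlt linearB /= => /predU1P[->|ja].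
  by rewrite (pr_id (prV a v)) ?subrr.
by rewrite (va j ja) (pr_out (prV a v)) ?subr0 // lt_eqF.
Qed.

(** Provides the start of the induction in [centralizer_filtered]. *)
Lemma filtered_bound : exists M : nat, forall v, filtered (- M%:Z) v.
Proof.
have [M sM] : exists M : nat, forall i, i \in s0 -> - M%:Z <= i.
  elim: s0 => [|i s [M sM]]; first by exists 0%N.
  exists (M + `|i|)%N => j; rewrite inE => /predU1P[->|/sM]; lia.
exists M => v j jM; rewrite [v]pr_sum linear_sum /= big_seq big1 // => i /sM iM.
by rewrite (pr_out (prV i v)) //; apply: contraTneq jM => ->; rewrite -leNgt.
Qed.

Section OGood.
Context (Q : V -> k) (hQ : quadratic_form Q) (hnd : nondegenerate_on Q fullv).
Context (polar_out : forall (i j : int) (v w : V),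
  i + j != 0 -> v \in Vi i -> w \in Vi j -> polar Q v w = 0).
Context (quad_out : forall (i : int) (v : V), i != 0 -> v \in Vi i -> Q v = 0).
Local Notation polar := (polar Q).

Lemma polar_pr j v w : w \in Vi j -> polar v w = polar (pr (- j) v) w.
Proof.
move=> wj; have lw : linear ((fun v => polar v w) : V -> k^o).
  by move=> c a b; rewrite polarDl // polarZl.
have [F FE] := lfun_of_linear lw.
rewrite -[LHS]FE -[RHS]FE -[RHS](comp_lfunE F (pr (- j))).
have := @homogeneous_ext _ F (F \o pr (- j))%VF; apply=> i u ui.
rewrite comp_lfunE; case: (eqVneq (- j) i) => [ji|ji].
  by rewrite pr_id // ji.
rewrite (pr_out ui) // linear0 FE; apply: polar_out ui wj.
by rewrite addr_eq0 eq_sym.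
Qed.

Lemma filtered_polar a b v w : 0 < a + b -> filtered a v -> filtered b w -> polar v w = 0.
Proof.
move=> ab va wb; rewrite [w]pr_sum polar_sumr // big1 // => i _.
rewrite (polar_pr _ (prV i w)); have [ib|bi] := ltP i b.
  by rewrite (wb i) // polar0r.
by rewrite (va (- i)) ?polar0l //; lia.
Qed.

Lemma filtered_quad v : filtered 1 v -> Q v = 0.
Proof.
move=> v1; rewrite [v]pr_sum quad_sum0 // => [i|i j].
  by have [->|i0] := eqVneq i 0; [rewrite v1 // quad0 | apply: quad_out (prV i v)].
have [ij|ij] := eqVneq (i + j) 0; last exact: polar_out ij (prV i v) (prV j v).
have [i1|i1] := ltP i 1; first by rewrite (v1 i) ?polar0l.
by rewrite (v1 j) ?polar0r //; lia.
Qed.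

Lemma homogeneous_nondegenerate i v : v \in Vi i -> Q v = 0 ->
  (forall w, w \in Vi (- i) -> polar v w = 0) -> v = 0.
Proof.
move=> vi Qv v0; apply: (nondegenerate_eq0 hQ hnd) Qv => w.
by rewrite polarC (polar_pr _ vi) polarC v0.
Qed.

(** A component of degree [j <= a] pairs only with [Vi (- j)], which lies in the step [- a] of the
    filtration. Orthogonality thus kills it when [j != 0], its [Q] being zero by degree. *)
Lemma filtered_orthogonal (a : int) v : 0 <= a ->
  filtered (a + 1) v <-> (forall w, filtered (- a) w -> polar v w = 0) /\ Q v = 0.
Proof.
move=> a0; split=> [va|[v0 Qv]].
  split=> [w|]; first by apply: filtered_polar va; lia.
  by apply: filtered_quad; apply: filtered_le va; lia.
have prw j : j < a + 1 -> forall w, w \in Vi (- j) -> polar (pr j v) w = 0.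
  move=> ja w wj; rewrite -[j]opprK -(polar_pr _ wj) v0 //.
  by apply: filtered_homogeneous wj _; lia.
have pr_neq0 j : j < a + 1 -> j != 0 -> pr j v = 0.
  move=> ja j0; apply: homogeneous_nondegenerate (prV j v) _ (prw _ ja).
  exact: quad_out j0 (prV j v).
move=> j ja; have [->{j ja}|] := eqVneq j 0; last exact: pr_neq0.
apply: homogeneous_nondegenerate (prV 0 v) _ (prw _ _); last by lia.
(* In degree 0 the hypothesis [Q v = 0] enters: the part of [v] above degree 0 is singular and
   orthogonal to [pr 0 v], so [Q (pr 0 v) = Q v]. *)
have v0' : filtered 0 v by move=> j j0; apply: pr_neq0; lia.
have := filtered_split v0'; rewrite add0r => v1.
have := quadD Q (pr 0 v) (v - pr 0 v); rewrite addrC subrK Qv (filtered_quad v1).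
rewrite (@filtered_polar 0 1) //; first by rewrite !addr0.
exact: filtered_homogeneous (prV _ _) _.
Qed.

(** * Powers of an element of degree 2 *)

Section Nilpotent.
Context (A : 'End(V)) (hA : orthogonal_algebra Q A).
Context (hA2 : forall r, (A @: Vi r <= Vi (r + 2))%VS).
Local Notation "A ^^ n" := (lfun_pow A n) (at level 29).

Lemma lfun_pow_homogeneous n i v : v \in Vi i -> (A ^^ n) v \in Vi (i + n%:Z *+ 2).
Proof.
move=> vi; elim: n => [|n IH]; first by rewrite lfun_pow0 mul0rn addr0.
rewrite lfun_powS; have := subvP (hA2 _) _ (memv_img A IH).
by congr (_ \in Vi _); lia.
Qed.

Lemma pr_lfun_pow n j v : pr j ((A ^^ n) v) = (A ^^ n) (pr (j - n%:Z *+ 2) v).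
Proof. by apply: pr_homogeneous => i w; apply: lfun_pow_homogeneous. Qed.

Lemma filtered_lfun_pow n a v : filtered a v ->
  filtered (a + n%:Z *+ 2) ((A ^^ n) v).
Proof. by move=> va j ja; rewrite pr_lfun_pow va ?linear0 //; lia. Qed.

(* Conditions (i) and (ii) at n, combined into one statement that does not
   depend on the characteristic. *)
Definition primitive_anisotropic (n : nat) : Prop := forall x,
  x \in Vi (- n%:Z) -> (A ^^ n) x = 0 ->
  (~~ odd n -> Q ((A ^^ n./2) x) = 0) -> x = 0.

Lemma polar_half_pow n x w : ~~ odd n ->
  polar ((A ^^ n./2) x) ((A ^^ n./2) w) = (-1) ^+ n./2 * polar x ((A ^^ n) w).
Proof.
by move=> nev; rewrite polar_lfun_pow // -lfun_powD addnn (even_halfK nev).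
Qed.

Lemma lfun_pow_eq0 n x : (0 < n)%N -> x \in Vi (- n%:Z) ->
  (forall w, w \in Vi (- n%:Z) -> polar ((A ^^ n) x) w = 0) -> (A ^^ n) x = 0.
Proof.
move=> n0 xn x0; have Anx := lfun_pow_homogeneous n xn.
apply: (homogeneous_nondegenerate Anx); first by apply: quad_out Anx; lia.
by move=> w wn; apply: x0; move: wn; congr (_ \in Vi _); lia.
Qed.

(** For odd [n], equal dimensions upgrade injectivity to bijectivity. For even [n > 0],
    [polar_half_pow] shows that [A^(n/2) x] is in the radical of the image exactly when
    [A^n x = 0]. *)
Lemma conditionsP (dimV : forall i : int, 0 <= i -> \dim (Vi i) = \dim (Vi (- i))) :
  odd_condition Vi A /\ even_condition Q Vi A <-> forall n, primitive_anisotropic n.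
Proof.
split=> [[oddA evA] n x xn Anx Qx|good].
  case: (boolP (odd n)) => nodd.
    have [_ inj _] := oddA n nodd; apply: inj; rewrite ?inE /= ?mem0v //.
    by rewrite Anx linear0.
  have [inj /(nondegenerate_onP hQ) nd] := evA n nodd.
  apply: inj; rewrite ?inE /= ?mem0v // linear0; apply: nd (Qx nodd).
    exact: memv_img.
  move=> _ /memv_imgP[w wn ->].
  by rewrite polarC polar_half_pow // Anx polar0r // mulr0.
have inj n : odd n -> {in [set` Vi (- n%:Z)] &, injective (A ^^ n)}.
  move=> nodd x y; rewrite !inE /= => xn yn /eqP; rewrite -subr_eq0 -linearB => /eqP An.
  by apply/eqP; rewrite -subr_eq0; apply/eqP/(good n); rewrite ?memvB // nodd.
split=> n nodd.
  have img x : x \in Vi (- n%:Z) -> (A ^^ n) x \in Vi n%:Z.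
    by move/(lfun_pow_homogeneous n); congr (_ \in Vi _); lia.
  split; [by move=> x /= /img | exact: inj |].
  have imE : ((A ^^ n) @: Vi (- n%:Z))%VS = Vi n%:Z.
    apply/eqP; rewrite eqEdim; apply/andP; split.
      by apply/subvP => _ /memv_imgP[x xn ->]; apply: img.
    rewrite dimV // limg_dim_eq //; apply/eqP; rewrite -subv0; apply/subvP => x.
    rewrite memv_cap memv_ker memv0 => /andP[xn /eqP Anx].
    by apply/eqP/(good n) => //; rewrite nodd.
  by move=> y /=; rewrite -imE => /memv_imgP[x xn ->]; exists x.
have half0 x : x \in Vi (- n%:Z) -> (A ^^ n./2) x = 0 -> x = 0.
  move=> xn Ax; apply: (good n) => // [|_]; last by rewrite Ax quad0.
  by rewrite -(even_halfK nodd) -addnn lfun_powD Ax linear0.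
split.
  move=> x y; rewrite !inE /= => xn yn /eqP; rewrite -subr_eq0 -linearB => /eqP An.
  by apply/eqP; rewrite -subr_eq0; apply/eqP/half0; rewrite ?memvB.
apply/(nondegenerate_onP hQ) => _ /memv_imgP[x xn ->] Ax0 Qx.
(* For [n = 0] the image is [Vi 0], whose nondegeneracy is inherited from that of [V]. *)
have [n0|n0] := posnP n.
  move: xn Ax0 Qx; rewrite n0 -[0./2]/0%N lfun_pow0 => x0 Ax0 Qx.
  apply: homogeneous_nondegenerate x0 Qx _ => w w0; apply: Ax0.
  by apply/memv_imgP; exists w => //; rewrite lfun_pow0.
suff -> : x = 0 by rewrite linear0.
apply: (good n) => //; apply: lfun_pow_eq0 => // w wn.
rewrite polar_lfun_pow //; apply/eqP; rewrite mulf_eq0 signr_eq0 /=.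
have := Ax0 _ (memv_img (A ^^ n./2) wn).
by rewrite polar_half_pow // => /eqP; rewrite mulf_eq0 signr_eq0.
Qed.

Lemma filtered_step (a : nat) v : primitive_anisotropic a ->
  filtered (- a%:Z + 1) v <->
  [/\ filtered (- a%:Z) v, filtered (a%:Z + 1) ((A ^^ a) v)
    & ~~ odd a -> Q ((A ^^ a./2) v) = 0].
Proof.
move=> good; split=> [va|[va Ava Qv]].
  split; first by apply: filtered_le va; lia.
    by have := filtered_lfun_pow (n := a) va; congr filtered; lia.
  move=> aev; apply: filtered_quad; have := filtered_lfun_pow (n := a./2) va.
  by congr filtered; lia.
move=> j; rewrite ltzD1 le_eqVlt => /predU1P[->|]; last exact: va.
apply: good => // [|aev].
  rewrite -[RHS](Ava a%:Z) ?ltzD1 // pr_lfun_pow.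
  by congr (_ (pr _ _)); lia.
(* [A^(a/2) v] is its degree 0 part plus a vector of degrees at least 1, which is singular and
   orthogonal to that part, so both have the same [Q]. *)
have v1 := filtered_lfun_pow (n := a./2) (filtered_split va).
have v0 := lfun_pow_homogeneous a./2 (prV (- a%:Z) v).
have := quadD Q ((A ^^ a./2) (pr (- a%:Z) v)) ((A ^^ a./2) (v - pr (- a%:Z) v)).
rewrite -linearD addrC subrK Qv // [Q (_ (v - _))]filtered_quad; last first.
  by apply: filtered_le v1; lia.
rewrite (filtered_polar _ (filtered_homogeneous v0 (lexx _)) v1); last by lia.
by rewrite !addr0.
Qed.

Lemma centralizer_filtered (g : 'End(V)) :
    (forall n, primitive_anisotropic n) -> orthogonal_group Q g ->
    (forall v, g (A v) = A (g v)) ->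
  forall a v, filtered a (g v) <-> filtered a v.
Proof.
move=> good [kerg gQ] gA.
have gAn n v : g ((A ^^ n) v) = (A ^^ n) (g v).
  by elim: n => [|n IH]; rewrite ?lfun_pow0 // !lfun_powS gA IH.
have gK : cancel (g^-1)%VF g by apply: lker0_lfunVK; apply/eqP.
have up (a : int) : 0 <= a -> (forall v, filtered (- a) (g v) <-> filtered (- a) v) ->
    forall v, filtered (a + 1) (g v) <-> filtered (a + 1) v.
  move=> a0 ga v; rewrite !filtered_orthogonal // gQ.
  split=> -[v0 Qv]; split=> // w wa.
    by rewrite -(isometry_polar gQ) v0 // ga.
  by rewrite -[w]gK (isometry_polar gQ) v0 // -ga gK.
have [M wM] := filtered_bound.
(* Descending induction on [a], with [m] as fuel: step [- (a + 1)] gives step [a + 2] by [up], and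
   the two together give step [- a] by [filtered_step]. *)
have neg m : forall a : nat, (M <= a + m)%N ->
    forall v, filtered (- a%:Z) (g v) <-> filtered (- a%:Z) v.
  elim: m => [|m IH] a Ma v.
    by split=> _; apply: filtered_le (wM _); lia.
  have ga := IH a.+1 ltac:(lia).
  have -> : - a%:Z = - a.+1%:Z + 1 by lia.
  have ua := up a.+1%:Z isT ga.
  split=> /(filtered_step _ (good _))[va Ava Qv]; apply/(filtered_step _ (good _)).
    by move: Ava Qv; rewrite -!gAn gQ => Ava Qv; split; [exact/ga | exact/ua |].
  by rewrite -!gAn gQ; split; [exact/ga | exact/ua |].
move=> a v; have [a0|a0] := leP a 0.
  have -> : a = - `|a|%N%:Z by lia.
  by apply: (neg M); lia.
have -> : a = (a - 1) + 1 by lia.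
apply: up; first by lia.
have -> : a - 1 = `|a - 1|%N%:Z by lia.
by apply: (neg M); lia.
Qed.

End Nilpotent.
End OGood.
End Graded.

(** * Elements of the centralizer *)

Section StringMaps.
Context (k : closedFieldType) (V : vectType k) (Q : V -> k) (hQ : quadratic_form Q).
Context (A : 'End(V)) (hA : orthogonal_algebra Q A).
Local Notation polar := (polar Q).
Local Notation "A ^^ n" := (lfun_pow A n) (at level 29).

(* The signs make this map telescope against A, so that it commutes with A as soon
   as A^(m+1) kills x and y. *)
Definition string_map (m : nat) (x y v : V) : V :=
  \sum_(i < m.+1) ((-1) ^+ i * polar v ((A ^^ i) y)) *: (A ^^ (m - i)) x.

Lemma string_map_linear m x y : linear (string_map m x y).
Proof.
move=> c v w; rewrite /string_map scaler_sumr -big_split /=; apply: eq_bigr => i _.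
by rewrite polarDl // polarZl // mulrDr scalerDl scalerA mulrCA.
Qed.

Lemma string_map_commute m x y v :
    (A ^^ m.+1) x = 0 -> (A ^^ m.+1) y = 0 ->
  string_map m x y (A v) = A (string_map m x y v).
Proof.
move=> Ax Ay.
(* By skewness term [i] on the left is [T i.+1], while term [i] on the right is [T i]. The two sums
   differ only in [T 0] and [T m.+1], which vanish. *)
pose T i := ((-1) ^+ i * polar v ((A ^^ i) y)) *: (A ^^ (m.+1 - i)) x.
have T0 : T 0%N = 0 by rewrite /T subn0 Ax scaler0.
have Tm : T m.+1 = 0 by rewrite /T Ay polar0r // mulr0 scale0r.
transitivity (\sum_(i < m.+1) T i.+1).
  apply: eq_bigr => i _; rewrite /T (orthogonal_algebra_skew hQ hA) -lfun_powS subSS.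
  by rewrite exprS mulN1r mulNr mulrN.
have <- : \sum_(i < m.+2) T i = \sum_(i < m.+1) T i.+1.
  by rewrite big_ord_recl T0 add0r.
rewrite big_ord_recr /= Tm addr0.
rewrite linear_sum; apply: eq_bigr => i _ /=.
by rewrite linearZ /= -lfun_powS /T subSn // -ltnS.
Qed.

Lemma polar_string_map m x y v : polar v (string_map m x y v) =
  \sum_(i < m.+1) (-1) ^+ i * (polar v ((A ^^ i) y) * polar v ((A ^^ (m - i)) x)).
Proof.
by rewrite polar_sumr //; apply: eq_bigr => i _; rewrite polarZr // mulrA.
Qed.

(** The reflection [i -> m - i] exchanges [x] and [y] and keeps the sign. Hence the antisymmetrized
    map has [polar v (B v) = 0]. *)
Lemma polar_string_map_even m x y v : ~~ odd m ->
  polar v (string_map m x y v) = polar v (string_map m y x v).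
Proof.
move=> mev; rewrite !polar_string_map (reindex_inj rev_ord_inj) /=.
apply: eq_bigr => i _; have im : (i <= m)%N by rewrite -ltnS.
rewrite subSS subKn // [polar v _ * _]mulrC; congr (_ * _).
by rewrite -signr_odd oddB // (negbTE mev) addFb signr_odd.
Qed.

(* The terms i and m - i cancel; summing over halves avoids dividing by 2. *)
Lemma polar_string_map_odd m x v : odd m -> polar v (string_map m x x v) = 0.
Proof.
move=> modd; rewrite polar_string_map.
pose F i := (-1) ^+ i * (polar v ((A ^^ i) x) * polar v ((A ^^ (m - i)) x)).
have Fm i : (i <= m)%N -> F (m - i)%N = - F i.
  move=> im; rewrite /F subKn // [polar v _ * _]mulrC -mulNr; congr (_ * _).
  by rewrite -signr_odd oddB // modd -(signr_odd _ i); case: (odd i); rewrite ?opprK.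
have hm : m.+1 = (m.+1./2 + m.+1./2)%N by rewrite addnn even_halfK //= modd.
rewrite -[LHS]/(\sum_(i < m.+1) F i) -(big_mkord xpredT F) {1}hm big_mkord big_split_ord /=.
rewrite [X in _ + X](reindex_inj rev_ord_inj) /= -big_split /= big1 // => i _.
have -> : (m.+1./2 + (m.+1./2 - i.+1) = m - i)%N by have := ltn_ord i; lia.
by rewrite Fm ?subrr //; have := ltn_ord i; lia.
Qed.

(** The values lie in the span of the [A^i x], a totally singular subspace. *)
Lemma quad_string_map m x y v :
    (forall i, Q ((A ^^ i) x) = 0) ->
    (forall i j, polar ((A ^^ i) x) ((A ^^ j) x) = 0) ->
  Q (string_map m x y v) = 0.
Proof.
move=> Qx px; apply: quad_sum0 => // [i|i j]; first by rewrite (quadZ hQ) Qx mulr0.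
by rewrite polarZl // polarZr // px !mulr0.
Qed.

Lemma polar_string_maps m x y x' y' v w :
    (forall i j, polar ((A ^^ i) x) ((A ^^ j) x') = 0) ->
  polar (string_map m x y v) (string_map m x' y' w) = 0.
Proof.
move=> px; rewrite polar_suml // big1 // => i _; rewrite polar_sumr // big1 // => j _.
by rewrite polarZl // polarZr // px !mulr0.
Qed.

End StringMaps.

(** * From the inclusion in the parabolic to conditions (i) and (ii) *)

Section Converse.
Context (k : closedFieldType) (V : vectType k) (Vi : int -> {vspace V}).
Context (pr : int -> 'End(V)).
Context (prV : forall i v, pr i v \in Vi i).
Context (pr_id : forall i v, v \in Vi i -> pr i v = v).
Context (pr_out : forall i j v, v \in Vi i -> j != i -> pr j v = 0).
Context (s0 : seq int) (pr_sum : forall v, v = \sum_(i <- s0) pr i v).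
Context (Q : V -> k) (hQ : quadratic_form Q) (hnd : nondegenerate_on Q fullv).
Context (polar_out : forall (i j : int) (v w : V),
  i + j != 0 -> v \in Vi i -> w \in Vi j -> polar Q v w = 0).
Context (quad_out : forall (i : int) (v : V), i != 0 -> v \in Vi i -> Q v = 0).
Context (A : 'End(V)) (hA : orthogonal_algebra Q A).
Context (hA2 : forall r, (A @: Vi r <= Vi (r + 2))%VS).
Context (dimV : forall i : int, 0 <= i -> \dim (Vi i) = \dim (Vi (- i))).
Context (dim_le : forall i : int, 0 <= i -> (\dim (Vi (- i - 2)) <= \dim (Vi (- i)))%N).
Context (dim_odd : forall i : int, odd `|i|%N -> ~~ odd (\dim (Vi i))).
Context (hfilt : forall g : 'End(V), special_orthogonal_group Q g ->
  (forall v, g (A v) = A (g v)) ->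
  forall a v, filtered pr a v -> filtered pr a (g v)).
Local Notation polar := (polar Q).
Local Notation filtered := (filtered pr).
Local Notation "A ^^ n" := (lfun_pow A n) (at level 29).

Let powV n i j v : v \in Vi i -> j = i + n%:Z *+ 2 -> (A ^^ n) v \in Vi j.
Proof. by move=> vi ->; apply: lfun_pow_homogeneous. Qed.

Let AV i j v : v \in Vi i -> j = i + 2 -> A v \in Vi j.
Proof. by move=> vi ->; apply: (subvP (hA2 _)); apply: memv_img. Qed.

Let nondeg_witness (n : nat) x : (0 < n)%N -> x \in Vi (- n%:Z) -> x != 0 ->
  exists2 v, v \in Vi n%:Z & polar v x != 0.
Proof.
move=> n0 xn /eqP x0; apply: contrapT => nE; apply: x0.
have Qx : Q x = 0 by apply: quad_out xn; lia.
apply: (homogeneous_nondegenerate prV pr_id pr_out pr_sum hQ hnd polar_out xn Qx).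
move=> w; rewrite opprK => wn; apply/eqP; apply: contrapT => /negP xw.
by apply: nE; exists w => //; rewrite polarC.
Qed.

Let curve_filtered (B C : 'End(V)) :
    (forall t v, Q (v + t *: B v + t ^+ 2 *: C v) = Q v) ->
    (forall v, B (A v) = A (B v)) -> (forall v, C (A v) = A (C v)) ->
  forall a v, filtered a v -> filtered a (v + B v + C v).
Proof.
move=> curveQ BA CA a v va.
have gE w : (\1 + B + C)%VF w = w + B w + C w by rewrite !add_lfunE id_lfunE.
rewrite -gE; apply: hfilt va => [|w]; first exact: quadratic_curve_special_orthogonal.
by rewrite !gE BA CA !linearD.
Qed.

Let line_filtered (B : V -> V) : linear B ->
    (forall v, Q (B v) = 0) -> (forall v, polar v (B v) = 0) ->
    (forall v, B (A v) = A (B v)) ->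
  forall a v, filtered a v -> filtered a (v + B v).
Proof.
move=> /lfun_of_linear[F FE] QB pB BA a v va.
have -> : v + B v = v + F v + (0 : 'End(V)) v by rewrite zero_lfunE addr0 FE.
apply: curve_filtered va.
- move=> t w; rewrite zero_lfunE scaler0 addr0 FE (quadD Q) (quadZ hQ) QB.
  by rewrite polarZr // pB !mulr0 !addr0.
- by move=> w; rewrite !FE BA.
- by move=> w; rewrite !zero_lfunE linear0.
Qed.

(* If A kills x in degree -n, then by duality and dim V_(n-2) >= dim V_n it also
   kills some y in degree n - 2, and the Eichler transformation of x and y
   commutes with A but lowers the degree. *)
Lemma lfun_inj_negative (m : nat) x : x \in Vi (- m.+2%:Z) -> A x = 0 -> x = 0.
Proof.
move=> xn Ax; apply/eqP; apply: contrapT => /negP x0.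
(* If [A] were injective on [Vi m], it would map onto [Vi (m + 2)] by dimension; then [x], killed by
   [A], would be orthogonal to [Vi (m + 2)]. *)
have [/eqP kerA|kerA] := boolP (Vi m%:Z :&: lker A == 0)%VS.
  have imA : (A @: Vi m%:Z)%VS = Vi m.+2%:Z.
    apply/eqP; rewrite eqEdim limg_dim_eq //; apply/andP; split.
      by apply/subvP => _ /memv_imgP[v vm ->]; apply: AV vm _; lia.
    rewrite (@dimV m%:Z isT) (@dimV m.+2%:Z isT); have := @dim_le m%:Z isT.
    by congr (\dim (Vi _) <= _)%N; lia.
  have [v] := nondeg_witness (ltn0Sn _) xn x0; rewrite -imA => /memv_imgP[u um ->].
  by rewrite (orthogonal_algebra_skew hQ hA) Ax polar0r // oppr0 eqxx.
pose y := vpick (Vi m%:Z :&: lker A)%VS.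
have y0 : y != 0 by rewrite vpick0.
have /andP[ym /eqP Ay] : (y \in Vi m%:Z) && (A y == 0).
  by rewrite -memv_ker -memv_cap memv_pick.
have Qx : Q x = 0 by apply: quad_out xn; lia.
have xy : polar x y = 0 by apply: polar_out xn ym; lia.
have xx : polar x x = 0 by rewrite polarvv // Qx mul0rn.
have [B BE] : exists B : 'End(V), forall v, B v = polar v x *: y - polar v y *: x.
  apply: lfun_of_linear => c u v; rewrite /= !polarDl // !polarZl //.
  move: (polar u x) (polar u y) (polar v x) (polar v y) => a b d e.
  by rewrite scalerBr !scalerDl !scalerA opprD addrACA.
(* The second-order correction for [Q y], which may be nonzero when [m = 0]. *)
have [C CE] : exists C : 'End(V), forall v, C v = - (Q y * polar v x) *: x.
  apply: lfun_of_linear => c u v; rewrite !polarDl // !polarZl //.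
  by rewrite scalerA -scalerDl; congr (_ *: _); ring.
have Av0 v z : A z = 0 -> polar (A v) z = 0.
  by move=> Az; rewrite (orthogonal_algebra_skew hQ hA) Az polar0r // oppr0.
have curveQ t v : Q (v + t *: B v + t ^+ 2 *: C v) = Q v.
  have -> : v + t *: B v + t ^+ 2 *: C v = v + ((t * polar v x) *: y
      + (- (t * polar v y) - t ^+ 2 * Q y * polar v x) *: x).
    rewrite BE CE scalerBr !scalerA -!addrA -scaleNr -scalerDl.
    by congr (_ + (_ + _ *: _)); ring.
  rewrite !(quadD Q) !(quadZ hQ) Qx !polarDr // !polarZr // polarZl // (polarC _ y x) xy.
  by ring.
have [v vn vx] := nondeg_witness (ltn0Sn _) xn x0.
have vy : polar v y = 0 by apply: polar_out vn ym; lia.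
have BA w : B (A w) = A (B w).
  by rewrite !BE !Av0 // !scale0r subrr linearB !linearZ /= Ax Ay oppr0 !scaler0 addr0.
have CA w : C (A w) = A (C w).
  by rewrite !CE Av0 // mulr0 oppr0 scale0r linearZ /= Ax scaler0.
have vfilt := filtered_homogeneous pr_out vn (lexx _).
have : pr m%:Z (v + B v + C v) = 0.
  by apply: (curve_filtered curveQ BA CA vfilt); lia.
rewrite BE CE vy scale0r subr0 !linearD !linearZ /= (pr_id ym).
rewrite (pr_out vn) ?(pr_out xn) ?scaler0 ?addr0 ?add0r; [|lia|lia].
by move=> /eqP; rewrite scaler_eq0 (negbTE vx) (negbTE y0).
Qed.

Lemma all_primitive_anisotropic n : primitive_anisotropic Vi Q A n.
Proof.
have [N] := ubnP n; elim: N n => // N IH [_ x _ | m]; first by rewrite lfun_pow0.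
rewrite ltnS => mN.
(* Here [n = m + 1]. If [n >= 2], [A z] satisfies the hypotheses of the claim at [n - 2], so
   [A z = 0] by induction, and [lfun_inj_negative] applies. *)
have injm z : z \in Vi (- m.+1%:Z) -> (A ^^ m.+1) z = 0 ->
    (~~ odd m.+1 -> Q ((A ^^ m.+1./2) z) = 0) -> (A ^^ m) z = 0 -> z = 0.
  case: m mN => [|m] mN zn Anz Qz Az; first by rewrite -(lfun_pow0 A z).
  apply: lfun_inj_negative (zn) _.
  apply: (IH m); first by lia.
  - by apply: AV zn _; lia.
  - by rewrite -lfun_powSr.
  - by move=> mev; rewrite -lfun_powSr -Qz //= ?negbK.
(* The degrees are opposite only for [i + j = m + 1], where the pairing is [polar x (A^(m+1) y)] up
   to sign. *)
have isotropic x y : x \in Vi (- m.+1%:Z) -> y \in Vi (- m.+1%:Z) ->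
    (A ^^ m.+1) y = 0 -> forall i j, polar ((A ^^ i) x) ((A ^^ j) y) = 0.
  move=> xn yn Ay i j; have [ij|ij] := eqVneq (i + j)%N m.+1.
    by rewrite (polar_lfun_pow hQ hA) -lfun_powD ij Ay polar0r // mulr0.
  apply: polar_out (lfun_pow_homogeneous hA2 i xn) (lfun_pow_homogeneous hA2 j yn).
  by lia.
have singular x : x \in Vi (- m.+1%:Z) ->
    (~~ odd m.+1 -> Q ((A ^^ m.+1./2) x) = 0) -> forall i, Q ((A ^^ i) x) = 0.
  move=> xn Qx i; have [im|im] := eqVneq (i + i)%N m.+1; last first.
    by apply: quad_out (lfun_pow_homogeneous hA2 i xn); lia.
  have -> : i = m.+1./2 by lia.
  by apply: Qx; rewrite -im addnn odd_double.
(* By degree, [v] pairs only with the term [i = 0]; the result sits in degree [m - 1], two below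
   [v]. *)
have string_top x y v : v \in Vi m.+1%:Z -> y \in Vi (- m.+1%:Z) ->
    string_map Q A m x y v = polar v y *: (A ^^ m) x.
  move=> vn yn; rewrite /string_map big_ord_recl big1 => [|i _].
    by rewrite addr0 (lfun_pow0 A) mul1r subn0.
  rewrite (polar_out _ vn (lfun_pow_homogeneous hA2 _ yn)) ?mulr0 ?scale0r //.
  by rewrite lift0; lia.
have top_eq0 v w : v \in Vi m.+1%:Z -> w \in Vi (m%:Z - 1) ->
    filtered m.+1%:Z (v + w) -> w = 0.
  move=> vn wm /(_ (m%:Z - 1)); rewrite linearD /= (pr_id wm) (pr_out vn) ?add0r.
    by apply; lia.
  by lia.
move=> x xn Ax Qx; apply/eqP; apply: contrapT => /negP x0.
have [v vn vx] := nondeg_witness (ltn0Sn _) xn x0.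
have vfilt := filtered_homogeneous pr_out vn (lexx _).
have powm z : z \in Vi (- m.+1%:Z) -> (A ^^ m) z \in Vi (m%:Z - 1).
  by move=> zn; apply: powV zn _; lia.
have [modd|mev] := boolP (odd m).
  have : polar v x *: (A ^^ m) x = 0.
    apply: (top_eq0 _ _ vn); first by rewrite memvZ ?powm.
    rewrite -(string_top _ _ _ vn xn); apply: line_filtered => //.
    - exact: string_map_linear.
    - by move=> w; apply: quad_string_map; [|exact: singular|exact: isotropic].
    - by move=> w; apply: polar_string_map_odd.
    - by move=> w; apply: string_map_commute.
  move/eqP; rewrite scaler_eq0 (negbTE vx) /= => /eqP Amx.
  by move/eqP: x0; apply; apply: injm.
(* A complement of the line of [x]: its dimension is odd, and a radical vector found in it is
   independent of [x]. *)
pose W := (Vi (- m.+1%:Z) :\: <[x]>)%VS.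
have WV z : z \in W -> z \in Vi (- m.+1%:Z) by apply: (subvP (diffvSl _ _)).
have dW : odd (\dim W).
  have xV : (<[x]> <= Vi (- m.+1%:Z))%VS by rewrite -memvE.
  have := dimv_cap_compl (Vi (- m.+1%:Z)) <[x]>.
  rewrite (capv_idPr xV) dim_vline x0 => dE.
  have : ~~ odd (\dim (Vi (- m.+1%:Z))) by apply: dim_odd; rewrite abszN /= mev.
  by rewrite -dE /= negbK.
pose om u w := polar u ((A ^^ m.+1) w).
have omr u : scalar (om u) by move=> c a b; rewrite /om linearP polarDr // polarZr.
have oml w : scalar (om^~ w) by move=> c a b; rewrite /om polarDl // polarZl.
(* With [w = A^(m/2) u], this is [polar w (A w)] up to sign, zero in every characteristic because
   [A] is in the orthogonal algebra. *)
have om0 u : om u u = 0.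
  have mE : m.+1 = (m./2 + m./2.+1)%N by lia.
  apply/eqP; rewrite /om mE lfun_powD -[polar _ _](mulKf (x := (-1) ^+ m./2)) ?signr_eq0 //.
  by rewrite -polar_lfun_pow // lfun_powS polarC hA.1 mulr0.
have [y [yW y0] yW0] := alternating_odd_degenerate oml omr om0 dW.
have yn := WV _ yW.
(* [y] is [om]-orthogonal to [W] by choice and to [x] because [A^(m+1) x = 0]; together these span
   [Vi (- (m + 1))]. *)
have Ay : (A ^^ m.+1) y = 0.
  apply: (lfun_pow_eq0 prV pr_id pr_out pr_sum hQ hnd polar_out quad_out hA2) => // w wn.
  have : w \in (W + <[x]>)%VS.
    by rewrite addv_diff (subvP (addvSl _ _)).
  case/memv_addP=> w1 w1W [_ /vlineP[c ->] ->].
  rewrite polar_lfun_pow // linearD linearZ /= Ax scaler0 addr0.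
  by have := yW0 _ w1W; rewrite /om => ->; rewrite mulr0.
have odd_only z : ~~ odd m.+1 -> Q ((A ^^ m.+1./2) z) = 0 by rewrite /= mev.
(* Chosen so that [A^m z] is the value at [v] of the antisymmetrized string map. As
   [polar v x != 0], [z = 0] would put [y] on the line of [x]. *)
pose z := polar v y *: x - polar v x *: y.
have zn : z \in Vi (- m.+1%:Z) by rewrite memvB ?memvZ.
have Amz : (A ^^ m) z = 0.
  have : polar v y *: (A ^^ m) x - polar v x *: (A ^^ m) y = 0.
    apply: (top_eq0 _ _ vn); first by rewrite memvB ?memvZ ?powm.
    rewrite -(string_top _ _ _ vn xn) -(string_top _ _ _ vn yn).
    apply: (@line_filtered (fun v => string_map Q A m x y v - string_map Q A m y x v)) => //.
    - move=> c a b; rewrite !(string_map_linear hQ).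
      by rewrite scalerBr opprD addrACA.
    - move=> w; rewrite (quadD Q) (quadN hQ) polarNr // polar_string_maps //; last exact: isotropic.
      rewrite !quad_string_map //; first by rewrite oppr0 !addr0.
      + exact: (singular _ yn (odd_only y)).
      + exact: isotropic.
      + exact: (singular _ xn Qx).
      + exact: isotropic.
    - by move=> w; rewrite polarBr // polar_string_map_even // subrr.
    - by move=> w; rewrite !string_map_commute // linearB.
  by rewrite /z linearB !linearZ.
have z0 : z = 0.
  apply: injm => //; last exact: odd_only.
  by rewrite /z linearB !linearZ /= Ax Ay oppr0 !scaler0 addr0.
have yx : y \in <[x]>%VS.
  apply/vlineP; exists ((polar v x)^-1 * polar v y).
  by rewrite -scalerA; move/eqP: z0; rewrite subr_eq0 => /eqP ->; rewrite scalerA mulVf // scale1r.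
have : y \in (W :&: <[x]>)%VS by rewrite memv_cap yW.
by rewrite capv_diff memv0 (negbTE y0).
Qed.

End Converse.

(** * Weight spaces of the cocharacter *)

(** Any non-root of [X (X^n - 1)] with [n = |i - j|] serves. *)
Lemma exprz_separates (k : closedFieldType) (i j : int) : i != j ->
  exists2 a : k, a != 0 & a ^ i != a ^ j.
Proof.
move=> ij; pose n := `|i - j|%N; have n0 : (0 < n)%N by rewrite /n; lia.
have /closed_nonrootP[a] : 'X * ('X^n - 1%:P) != 0 :> {poly k}.
  by rewrite mulf_neq0 ?polyX_eq0 // monic_neq0 // monicXnsubC.
rewrite rootE !hornerE mulf_eq0 negb_or subr_eq0 => /andP[a0 an]; exists a => //.
apply: contraNneq an => aij.
have : a ^ (i - j) = 1 by rewrite expfzDr // aij -expfzDr // subrr.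
have [-> /eqP //|->] : i - j = n%:Z \/ i - j = - n%:Z by rewrite /n; lia.
by rewrite -invr_expz => /(congr1 (@GRing.inv k)); rewrite invrK invr1 => /eqP.
Qed.

Section Weights.
Context (k : closedFieldType) (V : vectType k) (Vi : int -> {vspace V}).
Context (pr : int -> 'End(V)).
Context (prV : forall i v, pr i v \in Vi i).
Context (pr_id : forall i v, v \in Vi i -> pr i v = v).
Context (pr_out : forall i j v, v \in Vi i -> j != i -> pr j v = 0).
Context (s0 : seq int) (pr_sum : forall v, v = \sum_(i <- s0) pr i v).
Context (delta : k -> 'End(V)) (hdelta : cocharacter_of Vi delta).

Lemma cocharacter_comp (x : 'End(V)) (i : int) (a : k) : a != 0 ->
    (forall r, (x @: Vi r <= Vi (r + i))%VS) ->
  (delta a \o x)%VF = a ^ i *: (x \o delta a)%VF.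
Proof.
move=> a0 xi; apply/lfunP; apply: (homogeneous_ext prV pr_sum) => r v vr.
rewrite scale_lfunE !comp_lfunE (hdelta a0 vr).
rewrite (hdelta a0 (subvP (xi r) _ (memv_img x vr))).
by rewrite linearZ scalerA -expfzDr // addrC.
Qed.

(** Makes the inverse inside [Ad] a genuine one; [delta a^-1] is a left inverse on homogeneous
    vectors. *)
Lemma cocharacter_ker a : a != 0 -> lker (delta a) == 0%VS.
Proof.
move=> a0; apply/lker0P/(can_inj (g := delta a^-1)) => v; rewrite -comp_lfunE.
rewrite -[RHS]id_lfunE; apply: (homogeneous_ext prV pr_sum) => r w wr.
rewrite comp_lfunE (hdelta a0 wr) linearZ /= (hdelta _ wr) ?invr_eq0 // id_lfunE.
by rewrite scalerA -expfzMl divff // exp1rz scale1r.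
Qed.

(** For [v] of degree [r], [delta a] scales [x v] by [a^(r+i)] and its component of degree [j] by
    [a^j], so [exprz_separates] kills every component with [j != r + i]. *)
Lemma weight_spaceE (Q : V -> k) (i : int) :
  weight_space Q delta i = orthogonal_algebra_deg Q Vi i.
Proof.
apply/seteqP; split=> x /= [xQ xi]; split=> //.
  move=> r; apply/subvP => _ /memv_imgP[v vr ->].
  have prx j : j != r + i -> pr j (x v) = 0.
    move=> jri; have [a a0 aj] := exprz_separates k jri.
    have dxv : delta a (x v) = a ^ (r + i) *: x v.
      have := congr1 (fun f : 'End(V) => f (delta a v)) (xi a a0).
      rewrite /Ad !comp_lfunE scale_lfunE lker0_lfunK ?cocharacter_ker // => ->.
      by rewrite (hdelta a0 vr) linearZ scalerA -expfzDr // addrC.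
    have dpr w : pr j (delta a w) = a ^ j *: pr j w.
      rewrite (pr_homogeneous prV pr_id pr_out pr_sum (d := 0)) ?subr0.
        by rewrite (hdelta a0 (prV j w)).
      by move=> l u ul; rewrite addr0 (hdelta a0 ul) memvZ.
    have := dpr (x v); rewrite dxv linearZ /= => /eqP; rewrite -subr_eq0 -scalerBl.
    by rewrite scaler_eq0 subr_eq0 eq_sym (negbTE aj) => /eqP.
  rewrite [x v]pr_sum; apply: rpred_sum => j _.
  by have [->|/prx ->] := eqVneq j (r + i); rewrite ?prV ?mem0v.
move=> a a0; rewrite /Ad (cocharacter_comp a0 xi) -comp_lfunZl -comp_lfunA.
by rewrite lker0_compfV ?cocharacter_ker // comp_lfun1r.
Qed.

End Weights.

Theorem mainTheorem5 (k : closedFieldType) (V : vectType k) (Q : V -> k)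
    (hQ : quadratic_form Q) (hnd : nondegenerate_on Q fullv)
    (Vi : int -> {vspace V}) (hV : o_good Q Vi)
    (delta : k -> 'End(V)) (hdelta : cocharacter_of Vi delta) :
  weight_space_bang Q Vi delta = orthogonal_algebra_deg2_0 Q Vi /\
  (forall A : 'End(V), orthogonal_algebra_deg Q Vi 2 A ->
    (centralizer Q A `<=` parabolic Q Vi <->
     odd_condition Vi A /\ even_condition Q Vi A)).
Proof.
have [gr hdim dim_odd polar_out quad_out] := hV.
have dimV (i : int) : 0 <= i -> \dim (Vi i) = \dim (Vi (- i)) by move/hdim => [].
have dim_le (i : int) : 0 <= i -> (\dim (Vi (- i - 2)%R) <= \dim (Vi (- i)))%N by move/hdim => [].
have [pr [prV pr_id pr_out [s0 _ pr_sum]]] := grading_projections gr.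
have filtP := filtrationP prV pr_out pr_sum.
have main (A : 'End(V)) : orthogonal_algebra_deg Q Vi 2 A ->
    (centralizer Q A `<=` parabolic Q Vi <->
     odd_condition Vi A /\ even_condition Q Vi A).
  move=> [hA hA2].
  rewrite (conditionsP prV pr_id pr_out pr_sum hQ hnd polar_out quad_out hA hA2 dimV).
  split=> [cent n|good g [gSO gA]].
    apply: (all_primitive_anisotropic prV pr_id pr_out pr_sum hQ hnd polar_out) => //.
    move=> g gSO gA a v va.
    have [|_ /(_ a) gfilt] := cent g.
      have [kerg _] := special_orthogonal_isometry gSO.
      split=> //; rewrite /Ad; have -> : (g \o A)%VF = (A \o g)%VF.
        by apply/lfunP => w; rewrite !comp_lfunE gA.
      by rewrite -comp_lfunA lker0_compfV ?comp_lfun1r //; apply/eqP.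
    by apply/filtP; rewrite -gfilt; exists v => //; apply/filtP.
  have gO := special_orthogonal_isometry gSO; have [/eqP kerg _] := gO.
  have gfilt := centralizer_filtered prV pr_id pr_out pr_sum hQ hnd polar_out
    quad_out hA2 good gO.
  have {}gfilt a v : filtered pr a (g v) <-> filtered pr a v.
    apply: gfilt => w; rewrite -{2}gA /Ad !comp_lfunE lker0_lfunK //.
  split=> // a; apply/seteqP; split=> v.
    by move=> [w /filtP wa <-]; apply/filtP/gfilt.
  (* The reverse inclusion uses the other half of the equivalence [gfilt], applied to the preimage
     of [v]. *)
  move=> /filtP va; exists ((g^-1)%VF v); last exact: lker0_lfunVK.
  by apply/filtP/gfilt; rewrite lker0_lfunVK.
split=> //; apply/seteqP; split=> A; rewrite /weight_space_bang /=.
  rewrite (weight_spaceE prV pr_id pr_out pr_sum hdelta) => -[A2 /(main _ A2)[oddA evA]].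
  by split.
move=> [A2 oddA evA].
by rewrite (weight_spaceE prV pr_id pr_out pr_sum hdelta); split=> //; apply/main.
Qed.
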